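(* For every real number $\theta > 0$ there exists a constant $K_{\theta} > 0$, depending only on $\theta$, such that for every integer $n \ge 2$, if $n_1, n_2, \ldots, n_{\phi(n)}$ denote the $\phi(n)$ positive integers less than $n$ and relatively prime to $n$, then $$\left( \prod_{i=1}^{\phi(n)} R(n_i) \right)^{\frac{1}{\phi(n)}} > K_{\theta}\, R(n)^{-\theta}\, n .$$
   Context: For a positive integer $n = p_1^{a_1} p_2^{a_2} \cdots p_\omega^{a_\omega}$ with distinct primes $p_1,\ldots,p_\omega$ and exponents $a_j \ge 1$, the radical of $n$ is $R(n) = p_1 p_2 \cdots p_\omega$, with $R(1) = 1$ (empty product). $\phi$ denotes Euler's totient function. *)

(* Defs.v *)
From mathcomp Require Import all_boot.

Set Implicit Arguments.
Unset Strict Implicit.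
Unset Printing Implicit Defensive.

(* [primes n] is the duplicate-free list of prime divisors of [n] when [0 < n];
   [primes 1 = [::]], hence [radical 1 = 1]. *)
Definition radical (n : nat) : nat := \prod_(p <- primes n) p.

(* Main.v *)
Require Import Defs.
From mathcomp Require Import all_boot all_order all_algebra.
From mathcomp Require Import reals sequences exp.
From mathcomp Require Import ring lra zify.

Set Implicit Arguments.
Unset Strict Implicit.
Unset Printing Implicit Defensive.

Import Order.TTheory GRing.Theory Num.Theory.
Local Open Scope ring_scope.

(* Take logarithms. Without the coprimality condition, the total loss
   sum_(m <= n) (ln n - ln R(m)) splits into sum (ln n - ln m) <= n and
   sum (ln m - ln R(m)) = sum_p ln p * sum_(k >= 2) floor(n / p^k) <= 2 n.
   All the terms are nonnegative, so restricting to m coprime to n costs at most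
   3 n / phi(n) on average.  If n has w distinct prime factors then
   n / phi(n) <= w + 1, and w <= theta ln R(n) + C_theta because only boundedly
   many primes p have theta ln p < 1. *)

(** * Integer estimates: the ratio of n to its totient, and prime powers in factorials *)

Lemma radical_gt0 n : (0 < radical n)%N.
Proof.
rewrite /radical big_seq prodn_cond_gt0 // => p.
by rewrite mem_primes => /andP[/prime_gt0].
Qed.

(* The i-th term of s is at least k + i, so the product of p / (p - 1) over s is
   at most the telescoping product of (k + i) / (k + i - 1). *)
Lemma prod_increasing_leq (f : nat -> nat) (s : seq nat) (k : nat) :
  (0 < k)%N -> path ltn k s ->
  (k * \prod_(p <- s) (p * f p) <= (k + size s) * \prod_(p <- s) (p.-1 * f p))%N.
Proof.
elim: s k => [|p s IHs] k k_gt0 /=; first by rewrite !big_nil addn0.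
move=> /andP[ltkp pth]; rewrite !big_cons.
have {}pth : path ltn k.+1 s.
  by case: s pth {IHs} => //= q s /andP[ltpq ->]; rewrite (leq_ltn_trans ltkp ltpq).
have := IHs _ (ltn0Sn k) pth.
set A := \prod_(j <- s) _; set B := \prod_(j <- s) _ => leAB.
(* The difference of the two sides is p - (k + 1), nonnegative because k < p. *)
have lekp : (k * p <= k.+1 * p.-1)%N by nia.
apply: (@leq_trans (k.+1 * p.-1 * f p * A)).
  by rewrite !mulnA !leq_mul2r lekp !orbT.
rewrite -addSnnS.
apply: (@leq_trans (p.-1 * f p * (k.+1 * A))); first by lia.
apply: (@leq_trans (p.-1 * f p * ((k.+1 + size s) * B))); last by lia.
by rewrite leq_mul2l leAB orbT.
Qed.

(** With k = 1 and f p = p ^ (v_p(n) - 1), the two products of the previous lemma are n and its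
    totient. *)
Lemma leq_totient_omega n :
  (0 < n)%N -> (n <= (size (primes n)).+1 * totient n)%N.
Proof.
move=> n_gt0; rewrite totientE //.
have pth : path ltn 1 (primes n).
  rewrite path_min_sorted ?sorted_primes //; apply/allP => p.
  by rewrite mem_primes => /andP[/prime_gt1].
have := prod_increasing_leq (fun p => p ^ (logn p n).-1)%N (ltn0Sn 0) pth.
rewrite mul1n add1n; apply: leq_trans.
rewrite {1}(prod_prime_decomp n_gt0) prime_decompE big_map /=.
apply/eq_leq/eq_big_seq => p pn.
by rewrite -expnS prednK // logn_gt0.
Qed.

(* The last summand on the left strengthens the geometric bound enough to make
   it provable by induction on N. *)
Lemma sum_divn_expn_leq p n N : (0 < p)%N ->
  (p.-1 * (\sum_(2 <= k < N.+2) n %/ p ^ k) + n %/ p ^ N.+1 <= n %/ p)%N.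
Proof.
move=> p_gt0; elim: N => [|N IHN]; first by rewrite big_nil muln0 expn1.
rewrite big_nat_recr //= (expnSr p N.+1) divnMA.
have := leq_divM (n %/ p ^ N.+1) p.
move: IHN; set q := (n %/ p ^ N.+1)%N; nia.
Qed.

Lemma sum_dvdn p n : (0 < p)%N -> (\sum_(1 <= m < n.+1) (p %| m) = n %/ p)%N.
Proof.
move=> p_gt0; elim: n => [|n IHn]; first by rewrite big_nil div0n.
by rewrite big_nat_recr //= IHn divnS // addnC.
Qed.

Lemma sum_logn p n : (\sum_(1 <= m < n.+1) logn p m = logn p n`!)%N.
Proof.
elim: n => [|n IHn]; first by rewrite big_nil logn1.
by rewrite big_nat_recr //= IHn factS lognM ?fact_gt0 // addnC.
Qed.

(** In Legendre's formula, removing the k = 1 term leaves a geometric tail, at most floor(n / p) /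
    (p - 1). Denominators are cleared to stay in [nat]. *)
Lemma logn_fact_excess p n : prime p ->
  (p * p.-1 * (logn p n`! - n %/ p) <= n)%N.
Proof.
move=> p_pr; have p_gt0 := prime_gt0 p_pr.
case: n => [|n]; first by rewrite logn1 sub0n muln0.
rewrite logn_fact // big_nat_recl // expn1 addKn.
have := sum_divn_expn_leq n.+1 n p_gt0; have := leq_divM n.+1 p.
set S := (\sum_(2 <= k < n.+2) _)%N; set S' := (\sum_(_ <= _ < _) _)%N.
have -> : S' = S by rewrite /S big_add1.
move=> leq_n /(leq_trans (leq_addr _ _)) le_S.
by apply: leq_trans leq_n; rewrite -mulnA mulnC leq_mul2r le_S orbT.
Qed.

(** * Logarithmic sums over the reals *)

Section RealEstimates.
Variable R : realType.
Implicit Types (n m p : nat) (theta : R).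

Lemma ln_prodn (I : eqType) (r : seq I) (P : pred I) (F : I -> nat) :
  (forall i, i \in r -> P i -> 0 < F i)%N ->
  ln ((\prod_(i <- r | P i) F i)%N%:R : R) = \sum_(i <- r | P i) ln (F i)%:R.
Proof.
elim: r => [|i r IHr] F_gt0; first by rewrite !big_nil ln1.
rewrite !big_cons; have {}IHr := IHr (fun j jr => F_gt0 j (mem_behead (s := i :: r) jr)).
case: ifP => // Pi; rewrite natrM lnM ?IHr // posrE ltr0n ?F_gt0 ?mem_head //.
rewrite big_seq_cond prodn_cond_gt0 // => j /andP[jr].
by apply: F_gt0; rewrite in_cons jr orbT.
Qed.

Lemma ln_natr_ge0 n : 0 <= ln (n%:R : R).
Proof. by case: n => [|n]; [rewrite ln0 | rewrite ln_ge0 // ler1n]. Qed.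

(** The range of p depends on n only, so that sums over m <= n and over p can be exchanged; a p that
    is not prime has valuation 0. *)
Lemma ln_logn n m : (0 < m <= n)%N ->
  ln (m%:R : R) = \sum_(0 <= p < n.+1) (logn p m)%:R * ln p%:R.
Proof.
move=> /andP[m_gt0 lemn].
rewrite -{1}(partnT m_gt0) (widen_partn _ lemn) ln_prodn; last first.
  by move=> p _ _; apply: pfactor_gt0.
apply: eq_bigr => -[|p] _; first by rewrite lognE /= mul0r ln1.
by rewrite natrX lnXn ?ltr0n // mulr_natl.
Qed.

Lemma ln_radical n m : (0 < m <= n)%N ->
  ln ((radical m)%:R : R) = \sum_(0 <= p < n.+1) (p \in primes m)%:R * ln p%:R.
Proof.
move=> /andP[m_gt0 lemn].
rewrite ln_prodn => [|p]; last by rewrite mem_primes => /andP[/prime_gt0].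
under [RHS]eq_bigr do rewrite mulr_natl mulrb.
rewrite -big_mkcond -[RHS]big_filter; apply/perm_big/uniq_perm => [||p].
- exact: primes_uniq.
- by rewrite filter_uniq ?iota_uniq.
rewrite mem_filter mem_index_iota; apply/idP/idP => [pm|/andP[] //].
rewrite pm /= ltnS (leq_trans _ lemn) //.
by move: pm; rewrite mem_primes => /and3P[_ _ /dvdn_leq->].
Qed.

(** Here (ln x + 2) / x acts as a discrete primitive. With a = p - 1 and b = p, clearing
    denominators leaves 2 >= (a + 1) (ln b - ln a), and both a (ln b - ln a) and ln b - ln a are at
    most 1. *)
Lemma telescope_ln_term p : (1 < p)%N ->
  ln p%:R / (p * p.-1)%:R
    <= (ln p.-1%:R + 2) / p.-1%:R - (ln p%:R + 2) / p%:R :> R.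
Proof.
case: p => [|[|p]] // _; rewrite [_.-1]/= natrM -subr_ge0.
have a0 : (0 : R) < p.+1%:R by rewrite ltr0n.
have b0 : (0 : R) < p.+2%:R by rewrite ltr0n.
set a : R := p.+1%:R in a0 *; set b : R := p.+2%:R in b0 *.
have ba : b = a + 1 by rewrite /a /b -natr1.
have a1 : 1 <= a by rewrite /a ler1n.
clearbody a b.
have lnb : a * ln b <= a * ln a + 1.
  have -> : b = a * (1 + a^-1) by rewrite ba mulrDr mulr1 divff // gt_eqF.
  have aV_gt0 : 0 < a^-1 by rewrite invr_gt0.
  rewrite lnM ?posrE ?addr_gt0 //.
  rewrite mulrDr lerD2l -[leRHS](divff (lt0r_neq0 a0)) ler_pM2l // le_ln1Dx //.
  exact: lt_trans (ltrN10 _) aV_gt0.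
have la : ln b <= ln a + 1.
  have : ln b - ln a <= a * (ln b - ln a).
    rewrite ler_peMl // subr_ge0 ler_ln ?posrE //; lra.
  lra.
have -> : (ln a + 2) / a - (ln b + 2) / b - ln b / (b * a)
   = (b * ln a + 2 - a * ln b - ln b) / (b * a).
  rewrite ba; field; rewrite -ba; lra.
apply: divr_ge0; last by rewrite mulr_ge0 ?ltW.
rewrite {1}ba; lra.
Qed.

Lemma sum_ln_over_pp1_le n :
  \sum_(2 <= p < n.+1) ln p%:R / (p * p.-1)%:R <= 2 :> R.
Proof.
case: n => [|n]; first by rewrite big_geq.
(* The 2 is the value of (ln x + 2) / x at x = 1; keeping the subtracted term makes the induction
   telescope. *)
have : \sum_(2 <= p < n.+2) ln p%:R / (p * p.-1)%:R
   <= 2 - (ln n.+1%:R + 2) / n.+1%:R :> R.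
  elim: n => [|n IHn]; first by rewrite big_geq // ln1 add0r divr1 subrr.
  rewrite big_nat_recr //=.
  have := lerD IHn (telescope_ln_term (isT : 1 < n.+2)%N).
  by rewrite addrA subrK.
move/le_trans; apply; rewrite gerBl divr_ge0 // addr_ge0 //.
exact: ln_natr_ge0.
Qed.

Lemma sum_ln_sub_ln_radical_le n :
  \sum_(1 <= m < n.+1) (ln (m%:R : R) - ln (radical m)%:R) <= 2 * n%:R.
Proof.
have -> : \sum_(1 <= m < n.+1) (ln (m%:R : R) - ln (radical m)%:R)
  = \sum_(0 <= p < n.+1)
      (\sum_(1 <= m < n.+1) ((logn p m)%:R - (p \in primes m)%:R)) * ln p%:R.
  under [RHS]eq_bigr do rewrite mulr_suml.
  rewrite exchange_big; apply: eq_big_nat => m lemn.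
  rewrite (ln_logn lemn) (ln_radical lemn) -sumrB.
  by apply: eq_bigr => p _; rewrite mulrBl.
(* The indices p = 0 and p = 1 drop out since [ln] vanishes at both, by convention at 0. *)
rewrite big_ltn // [X in _ * X]ln0 // mulr0 add0r.
case: n => [|n]; first by rewrite big_geq // mulr0.
rewrite big_ltn // ln1 mulr0 add0r.
apply: (@le_trans _ _
  (\sum_(2 <= p < n.+2) n.+1%:R * (ln p%:R / (p * p.-1)%:R))).
  rewrite !big_nat; apply: ler_sum => p /andP[p_gt1 _].
  rewrite mulrCA mulrC; apply: ler_wpM2l; first exact: ln_natr_ge0.
  case: (boolP (prime p)) => [p_pr|pNpr]; last first.
    rewrite big1 ?divr_ge0 // => m _.
    by rewrite lognE mem_primes (negPf pNpr) subrr.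
  have p_gt0 := prime_gt0 p_pr.
  rewrite sumrB -!natr_sum sum_logn.
  have -> : (\sum_(1 <= m < n.+2) (p \in primes m) = n.+1 %/ p)%N.
    rewrite -sum_dvdn //; apply: eq_big_nat => m /andP[m_gt0 _].
    by rewrite mem_primes p_pr m_gt0.
  rewrite ler_pdivlMr ?ltr0n; last by rewrite muln_gt0; lia.
  (* This makes the truncated subtraction of [logn_fact_excess] agree with the real one. *)
  have ge : (n.+1 %/ p <= logn p (n.+1)`!)%N.
    by rewrite logn_fact // big_nat_recl // expn1 leq_addr.
  rewrite -natrB // -natrM ler_nat mulnC; exact: logn_fact_excess.
rewrite -mulr_sumr mulrC ler_wpM2r // ?ler0n //.
exact: sum_ln_over_pp1_le.
Qed.

(** A weak Stirling bound, n! >= (n / e)^n: passing from n to n + 1 adds n ln(1 + 1/n) <= 1. *)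
Lemma sum_ln_sub_ln_le n :
  \sum_(1 <= m < n.+1) (ln (n%:R : R) - ln m%:R) <= n%:R.
Proof.
elim: n => [|n IHn]; first by rewrite big_geq.
case: n IHn => [|n] IHn; first by rewrite big_nat1 subrr.
move: IHn; rewrite !sumrB !sumr_const_nat !subn1 /= => IHn.
rewrite (big_nat_recr n.+2) //=.
have -> : ln (n.+2%:R : R) = ln n.+1%:R + ln (1 + n.+1%:R^-1).
  rewrite -lnM ?posrE ?ltr0n //.
    by rewrite mulrDr mulr1 divff ?pnatr_eq0 // natr1.
  by rewrite addr_gt0 // invr_gt0 ltr0n.
have : n.+1%:R * ln (1 + n.+1%:R^-1) <= 1 :> R.
  rewrite -[leRHS](@divff _ (n.+1%:R)) ?pnatr_eq0 // ler_pM2l ?ltr0n //.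
  apply: le_ln1Dx; apply: (@lt_trans _ _ 0); first lra.
  by rewrite invr_gt0 ltr0n.
rewrite -mulr_natl in IHn; rewrite -mulr_natl.
rewrite -(natr1 n.+1); set a := n.+1%:R in IHn *; set S := \sum_(_ <= _ < _) _ in IHn *.
lra.
Qed.

Lemma sum_ln_sub_ln_radical_coprime_le n :
  \sum_(1 <= m < n | coprime m n) (ln (n%:R : R) - ln (radical m)%:R)
    <= 3 * n%:R.
Proof.
case: n => [|n]; first by rewrite big_geq // mulr0.
have radical_le m : (0 < m)%N -> ln ((radical m)%:R : R) <= ln m%:R.
  move=> m_gt0; rewrite (@ln_radical m) ?m_gt0 ?leqnn // (@ln_logn m m) ?m_gt0 ?leqnn //.
  apply: ler_sum => p _; apply: ler_wpM2r; first exact: ln_natr_ge0.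
  by rewrite ler_nat -logn_gt0; case: (logn p m).
have term1 m : (0 < m)%N -> 0 <= ln (m%:R : R) - ln (radical m)%:R.
  by move=> m_gt0; rewrite subr_ge0 radical_le.
have term2 m : (0 < m < n.+2)%N -> 0 <= ln (n.+1%:R : R) - ln m%:R.
  by case/andP=> m_gt0 ltmn; rewrite subr_ge0 ler_ln ?posrE ?ltr0n // ler_nat.
apply: (@le_trans _ _
  (\sum_(1 <= m < n.+2) (ln (n.+1%:R : R) - ln (radical m)%:R))).
  rewrite [leRHS]big_nat_recr //= big_mkcond /= -[leLHS]addr0 lerD //.
    rewrite !big_nat; apply: ler_sum => m /andP[m_gt0 ltmn].
    have := term1 m m_gt0; have := term2 m; rewrite m_gt0 ltnW // => /(_ isT).
    by case: ifP => _; lra.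
  exact: term1.
have -> : \sum_(1 <= m < n.+2) (ln (n.+1%:R : R) - ln (radical m)%:R)
  = \sum_(1 <= m < n.+2) (ln (n.+1%:R : R) - ln m%:R)
    + \sum_(1 <= m < n.+2) (ln (m%:R : R) - ln (radical m)%:R).
  by rewrite -big_split /=; apply: eq_bigr => m _; lra.
have := sum_ln_sub_ln_radical_le n.+1; have := sum_ln_sub_ln_le n.+1; lra.
Qed.

Lemma omega_le_ln_radical theta : 0 < theta ->
  exists C : R, forall n, (size (primes n))%:R <= theta * ln (radical n)%:R + C.
Proof.
(* A prime p >= M has theta ln p >= 1 and pays for itself; the primes below M number at most M,
   which serves as C. *)
move=> theta_gt0; pose M := Num.bound (expR theta^-1).
exists M%:R => n; rewrite ln_prodn => [|p]; last first.
  by rewrite mem_primes => /andP[/prime_gt0].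
rewrite -sum1_size natr_sum mulr_sumr.
apply: (@le_trans _ _ (\sum_(p <- primes n) (theta * ln p%:R + (p < M)%N%:R))).
  apply: ler_sum => p _; case: ltnP => [_|leMp].
    by rewrite lerDr mulr_ge0 ?ln_natr_ge0 // ltW.
  rewrite addr0 mulrC -ler_pdivrMr // div1r.
  have ltp : expR theta^-1 < p%:R.
    apply: (@lt_le_trans _ _ M%:R); last by rewrite ler_nat.
    by apply: archi_boundP; apply: expR_ge0.
  rewrite -[leLHS]expRK ler_ln ?posrE ?expR_gt0 ?ltW //.
  exact: lt_trans (expR_gt0 _) ltp.
rewrite big_split /= lerD2l -natr_sum ler_nat.
have -> : (\sum_(p <- primes n) (p < M) = count (gtn M) (primes n))%N.
  by rewrite -sum1_count [RHS]big_mkcond; apply: eq_bigr => p _; rewrite /=; case: (p < M)%N.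
rewrite -size_filter.
rewrite -[leqRHS](size_iota 0) uniq_leq_size ?filter_uniq ?primes_uniq // => p.
by rewrite mem_filter mem_iota => /andP[].
Qed.

End RealEstimates.

(** * From the average logarithmic loss to the geometric mean *)

Theorem mainTheorem1 (R : realType) (theta : R) (theta_gt0 : 0 < theta) :
  exists K : R, 0 < K /\
    forall n : nat, (2 <= n)%N ->
      ((\prod_(1 <= m < n | coprime m n) radical m)%N%:R : R)
          `^ (1 / (totient n)%:R)
        > K * (radical n)%:R `^ (- theta) * n%:R.
Proof.
have theta3_gt0 : 0 < theta / 3 by lra.
have [C omega_le] := omega_le_ln_radical theta3_gt0.
(* The average loss is at most 3 (w + 1) <= theta ln R(n) + 3 C + 3, which explains theta / 3;
   taking 4 instead of 3 gives strictness. *)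
exists (expR (- (4 + 3 * C))); split=> [|n n_gt1]; first exact: expR_gt0.
have n_gt0 : (0 < n)%N by apply: ltnW.
have phi_gt0 : (0 : R) < (totient n)%:R by rewrite ltr0n totient_gt0.
have P_gt0 : (0 < \prod_(1 <= m < n | coprime m n) radical m)%N.
  by rewrite prodn_cond_gt0 // => m _; apply: radical_gt0.
have Rn_gt0 : (0 : R) < (radical n)%:R by rewrite ltr0n radical_gt0.
have nR_gt0 : (0 : R) < n%:R by rewrite ltr0n.
have RnX_gt0 : 0 < (radical n)%:R `^ (- theta) :> R by apply: powR_gt0.
rewrite -ltr_ln ?posrE ?mulr_gt0 ?expR_gt0 ?powR_gt0 ?ltr0n ?radical_gt0 //.
rewrite !lnM ?posrE ?mulr_gt0 ?expR_gt0 // expRK !ln_powR div1r [ltRHS]mulrC ltr_pdivlMr //.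
rewrite [ltRHS]ln_prodn => [|m _ _]; last exact: radical_gt0.
have := sum_ln_sub_ln_radical_coprime_le R n; rewrite sumrB.
have -> : \sum_(1 <= m < n | coprime m n) ln (n%:R : R)
  = (totient n)%:R * ln n%:R.
  (* The totient counts from m = 0, which contributes nothing since gcd(n, 0) = n > 1. *)
  rewrite totient_count_coprime big_ltn // /coprime gcdn0 gtn_eqF // add0n.
  rewrite natr_sum mulr_suml big_mkcond; apply: eq_bigr => m _.
  by rewrite gcdnC; case: eqP; rewrite ?mul1r ?mul0r.
have := leq_totient_omega n_gt0.
rewrite -(ler_nat R) natrM -natr1 => n_le.
have {}omega_le := omega_le n.
set phi := (totient n)%:R in phi_gt0 n_le *.
(* Multiplying by [phi] beforehand leaves a goal linear in the monomials. *)
have : (size (primes n))%:R * phi <= (theta / 3 * ln (radical n)%:R + C) * phi.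
  by rewrite ler_pM2r.
set w := (size _)%:R in n_le *; set S := \sum_(_ <= _ < _ | _) _.
set l := ln (radical n)%:R; set L := ln n%:R.
lra.
Qed.
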